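(* Let $\mathbf X\in\mathbb R^d$ be elliptical with positive definite covariance $\boldsymbol\Sigma=\mathbf V\boldsymbol\Lambda\mathbf V'$ and $\mathbf Y=\mathbf V'\mathbf X$. For $\alpha\in(0,1)$ and $i\in\{1,\dots,d\}$ let $\boldsymbol\Lambda_{i,\alpha}:=\mathrm{Cov}(\mathbf Y\mid Y_i\in\mathsf T^\alpha_{Y_i})$ (the conditioning event having positive probability). Then $\mathrm{Tr}(\boldsymbol\Lambda_{1,\alpha})\le\mathrm{Tr}(\boldsymbol\Lambda_{i,\alpha})\le\mathrm{Tr}(\boldsymbol\Lambda_{d,\alpha})$ for all $i\in\{1,\dots,d\}$; i.e. the preserved total variance is maximized by peeling $Y_d$ and minimized by peeling $Y_1$.
   Context: A random vector $\mathbf X\in\mathbb R^d$ belongs to the elliptical family with parameters $(\boldsymbol\mu,\boldsymbol\Sigma,\phi)$ if its characteristic function is $\mathbb E[e^{i\mathbf t'\mathbf X}]=e^{i\mathbf t'\boldsymbol\mu}\phi(\mathbf t'\boldsymbol\Sigma\mathbf t)$ for all $\mathbf t\in\mathbb R^d$, for some scalar function $\phi$; here $\mathbf X$ is assumed to have finite second moments and covariance matrix $\boldsymbol\Sigma$, positive definite. Spectral decomposition: $\boldsymbol\Sigma=\mathbf V\boldsymbol\Lambda\mathbf V'$ with $\mathbf V$ orthogonal (orthonormal eigenvectors as columns) and $\boldsymbol\Lambda=\mathrm{diag}(\lambda_1,\dots,\lambda_d)$, $\lambda_1\ge\cdots\ge\lambda_d>0$. For a real random variable $W$, $Q_W(p)=\inf\{x:\mathbb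 P(W\le x)\ge p\}$ and $\mathsf T^\alpha_W:=[Q_W(\alpha/2),Q_W(1-\alpha/2)]$. *)

(* Defs.v *)
From mathcomp Require Import all_boot all_algebra.
From mathcomp Require Import all_classical all_reals all_analysis.
Set Implicit Arguments. Unset Strict Implicit. Unset Printing Implicit Defensive.
Import order.Order.TTheory GRing.Theory Num.Theory.
From mathcomp Require Import complex.
Local Open Scope ring_scope.
Local Open Scope classical_set_scope.

Section Defs.
Context {R : realType} {dT : measure_display} {T : measurableType dT}.
Variable P : probability T R.

Definition rexp (f : T -> R) : R := fine (\int[P]_w (f w)%:E)%E.

Definition rcov (f g : T -> R) : R :=
  rexp (fun w => (f w - rexp f) * (g w - rexp g)).

Definition condE (A : set T) (f : T -> R) : R :=
  fine (\int[P]_(w in A) (f w)%:E)%E / fine (P A).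

Definition quantile (W : T -> R) (p : R) : R :=
  inf [set x : R | (p%:E <= P [set w | (W w <= x)%R])%E].

Definition trim_event (W : T -> R) (alpha : R) : set T :=
  [set w | quantile W (alpha / 2) <= W w <= quantile W (1 - alpha / 2)].

Variable d : nat.

Definition condCov (A : set T) (Y : T -> 'cV[R]_d) : 'M[R]_d :=
  \matrix_(j, k) condE A (fun w => (Y w j 0 - condE A (fun v => Y v j 0)) *
                                   (Y w k 0 - condE A (fun v => Y v k 0))).

(* Elliptical family: E[exp(i t'X)] = exp(i t'mu) phi(t' Sigma t) for all t,
   with exp(i s) written as cos s + i sin s. *)
Definition elliptical (X : T -> 'cV[R]_d) (mu : 'cV[R]_d) (Sigma : 'M[R]_d)
    (phi : R -> R[i]) : Prop :=
  forall t : 'cV[R]_d,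
    ((rexp (fun w => cos ((t^T *m X w) 0 0))) +i*
     (rexp (fun w => sin ((t^T *m X w) 0 0))))%C
    = ((cos ((t^T *m mu) 0 0)) +i* (sin ((t^T *m mu) 0 0)))%C
      * phi ((t^T *m Sigma *m t) 0 0).

End Defs.

(* Main.v *)
(* A vector with an elliptical law is, up to an affine map, a vector [Z] whose
   characteristic function is invariant under orthogonal maps.  Functions
   obtained from the characters by linear combinations and bounded pointwise
   limits form an algebra that is stable under [expR] and hence contains
   the indicators of half-spaces, being limits of
   [expR (- expR (k - k^2 * m * sin (x / m)))]; so the truncated moments of [Z]
   are invariant too, and no inversion formula or density is needed.
   Peeling coordinate [i] leaves the total variance
   [\sum_j lam_j * v i j], where by exchangeability [v i i] and [v i j], [i != j],
   do not depend on the indices; exchanging the roles of [i] and [j] changes it by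
   [(lam_i - lam_j) * (v i i - v i j)], and [v i i <= v i j] by symmetrization. *)
Require Import Defs.
From mathcomp Require Import all_boot all_algebra.
From mathcomp Require Import all_classical all_reals all_analysis.
Import order.Order.TTheory GRing.Theory Num.Theory.
From mathcomp Require Import complex ring lra measurable_realfun fingroup perm.
Import numFieldNormedType.Exports.
Local Open Scope ring_scope.
Local Open Scope classical_set_scope.

(** * Sine and exponential estimates behind the bounded approximations *)

Section real_functions.
Context {R : realType}.
Implicit Types x y : R.

(** The mean value theorem between [0] and [x], with oddness for negative [x]. Both sine estimates
    below come from it. *)
Lemma sin_mean_value x : exists2 c, `|c| <= `|x| & sin x = cos c * x.
Proof.
wlog x0 : x / 0 <= x => [H|].
  have [/H//|x0] := leP 0 x.
  have [|c cx sx] := H (- x); first by rewrite oppr_ge0 ltW.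
  exists c; first by rewrite -[X in _ <= X]normrN.
  by apply: oppr_inj; rewrite -sinN sx mulrN.
have sinC : {within `[0, x], continuous (@sin R)}.
  by apply: continuous_subspaceT => z; exact: continuous_sin.
have [c] := MVT_segment x0 (fun z _ => is_derive_sin z) sinC.
rewrite in_itv/= => /andP[c0 cx]; rewrite sin0 !subr0 => sx.
by exists c => //; rewrite !ger0_norm.
Qed.

Lemma norm_sin_le x : `|sin x| <= `|x|.
Proof.
have [c _ ->] := sin_mean_value x.
by rewrite normrM ler_piMl// cos_max.
Qed.

Lemma norm_sin_sub_le x : `|sin x - x| <= x ^+ 2.
Proof.
have [c cx ->] := sin_mean_value x.
have cosB1 : 1 - cos c = sin (c / 2) ^+ 2 *+ 2.
  have -> : cos c = cos (c / 2 *+ 2) by congr cos; rewrite -mulr_natr divfK.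
  by rewrite cos_mulr2n sin2cos2; ring.
rewrite -{2}(mul1r x) -mulrBl normrM distrC cosB1.
rewrite -(real_normK (num_real x)) (expr2 `|x|) ler_wpM2r//.
rewrite normrMn normrX expr2 -[X in X <= _]mulr_natr -mulrA.
(* Of the two factors [sin (c / 2)], one is bounded by 1 and the other by [|c / 2|], so [1 - cos c]
   is at most [|c|]. *)
apply: (@le_trans _ _ (1 * (`|c / 2| * 2))).
  apply: ler_pM => //; first exact: sin_max.
  by rewrite ler_wpM2r// norm_sin_le.
by rewrite mul1r normrM [X in _ * X * _]ger0_norm// divfK.
Qed.

(** A bounded trigonometric substitute for the unbounded function [x]: it converges to [x] with
    error at most [x ^+ 2 / m.+1] and is dominated by [|x|]. *)
Definition sin_approx (m : nat) x : R := m.+1%:R * sin (x / m.+1%:R).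

Lemma norm_sin_approx_le m x : `|sin_approx m x| <= `|x|.
Proof.
rewrite /sin_approx normrM (le_trans (ler_wpM2l _ (norm_sin_le _)))//.
by rewrite -normrM mulrCA divff ?mulr1.
Qed.

Lemma cvg_sin_approx x : sin_approx ^~ x @ \oo --> x.
Proof.
have le m : `|sin_approx m x - x| <= x ^+ 2 * harmonic m.
  rewrite /sin_approx /harmonic /=.
  have m0 : m.+1%:R != 0 :> R by rewrite pnatr_eq0.
  have -> : m.+1%:R * sin (x / m.+1%:R) - x =
            m.+1%:R * (sin (x / m.+1%:R) - x / m.+1%:R) by field.
  rewrite normrM normr_nat (le_trans (ler_wpM2l _ (norm_sin_sub_le _)))//.
  by rewrite le_eqVlt; apply/orP; left; apply/eqP; field.
apply: (@squeeze_cvgr _ _ _ _ (fun m => x - x ^+ 2 * harmonic m)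
                              (fun m => x + x ^+ 2 * harmonic m)).
- by near=> m; have := le m; rewrite ler_distl.
- rewrite -[X in _ --> X]subr0 -[X in _ - X](mulr0 (x ^+ 2)).
  by apply: cvgB; [exact: cvg_cst|apply: cvgM; [exact: cvg_cst|exact: cvg_harmonic]].
- rewrite -[X in _ --> X]addr0 -[X in _ + X](mulr0 (x ^+ 2)).
  by apply: cvgD; [exact: cvg_cst|apply: cvgM; [exact: cvg_cst|exact: cvg_harmonic]].
Unshelve. all: by end_near. Qed.

(* The summand [k] pushes the borderline case [x = 0] to the limit [0]. *)
Definition step_approx (k : nat) x : R := expR (- expR (k%:R - k%:R ^+ 2 * x)).

Lemma step_approx_norm_le1 k x : `|step_approx k x| <= 1.
Proof.
by rewrite ger0_norm ?expR_ge0// /step_approx expR_le1 oppr_le0 expR_ge0.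
Qed.

(** For [x > 0], once [k * x >= 2] the inner exponent is at most [- k], so the outer one tends to 0.
    For [x <= 0], [expR y >= 1 + y] makes the inner exponential at least [k], so the value is at
    most [expR (- k)]. *)
Lemma cvg_step_approx x : step_approx ^~ x @ \oo --> ((0 < x)%R%:R : R).
Proof.
have [x0|x0] := ltP 0 x.
- rewrite -[X in _ --> X]expR0 -oppr0.
  apply: continuous_cvg; first exact: continuous_expR.
  apply: cvgN.
  have H := @cvgn_expR R.
  apply: (@squeeze_cvgr _ _ _ _ (fun=> 0) (fun n => expR (- n%:R))) => //; last exact: cvg_cst.
  near=> k; rewrite expR_ge0/= ler_expR.
  have kx : 2 <= k%:R * x.
    rewrite -ler_pdivrMr//; near: k; exact: nbhs_infty_ger.
  rewrite expr2 -mulrA.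
  have : k%:R * 2 <= k%:R * (k%:R * x) by rewrite ler_wpM2l.
  lra.
- have H := @cvgn_expR R.
  apply: (@squeeze_cvgr _ _ _ _ (fun=> 0) (fun n => expR (- n%:R))) => //; last exact: cvg_cst.
  near=> k; rewrite expR_ge0/= ler_expR lerN2.
  apply: le_trans (expR_ge1Dx _).
  have : k%:R ^+ 2 * x <= 0 by rewrite mulr_ge0_le0// sqr_ge0.
  lra.
Unshelve. all: by end_near. Qed.

(** A bound uniform in both [n] and [x], as bounded limits require when [expR] is applied to a
    bounded function. *)
Lemma norm_series_exp_coeff_le x M n : `|x| <= M ->
  `|series (exp_coeff x) n| <= expR M.
Proof.
move=> xM; have M0 : 0 <= M by exact: le_trans xM.
apply: (@le_trans _ _ (series (exp_coeff M) n)).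
  rewrite /series/= (le_trans (ler_norm_sum _ _ _))//; apply: ler_sum => i _.
  rewrite /exp_coeff/= normrM normrX (@ger0_norm _ (_^-1))//.
  by rewrite ler_wpM2r// lerXn2r// ?nnegrE.
apply: nondecreasing_cvgn_le; last exact: is_cvg_series_exp_coeff.
by apply/nondecreasing_seqP => k; rewrite seriesSr lerDl exp_coeff_ge0.
Qed.

End real_functions.

(** * The closure of the characters under bounded limits *)

Section trig_closure.
Context {R : realType} {n : nat}.
Implicit Types f g : 'cV[R]_n -> R.
Implicit Types t s x : 'cV[R]_n.

Definition linear_form (t x : 'cV[R]_n) : R := (t^T *m x) 0 0.

Lemma linear_formD t s x : linear_form (t + s) x = linear_form t x + linear_form s x.
Proof. by rewrite /linear_form linearD/= mulmxDl mxE. Qed.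

Lemma linear_formN t x : linear_form (- t) x = - linear_form t x.
Proof. by rewrite /linear_form linearN/= mulNmx mxE. Qed.

Lemma linear_formZ a t x : linear_form (a *: t) x = a * linear_form t x.
Proof. by rewrite /linear_form linearZ/= -scalemxAl mxE. Qed.

Lemma linear_form_delta i x : linear_form (delta_mx i 0) x = x i 0.
Proof. by rewrite /linear_form trmx_delta -rowE mxE. Qed.

(** The phase [c] makes sines available as shifted cosines and turns products of generators into
    sums of generators. The bound [M] is uniform in [k] and [x], so that limits pass through
    expectations by dominated convergence. *)
Inductive trig_closure : ('cV[R]_n -> R) -> Prop :=
| trig_closure_cos t c : trig_closure (fun x => cos (linear_form t x + c))
| trig_closure_lin a b f g : trig_closure f -> trig_closure g ->
    trig_closure (fun x => a * f x + b * g x)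
| trig_closure_lim (f_ : nat -> 'cV[R]_n -> R) f M :
    (forall k, trig_closure (f_ k)) -> (forall k x, `|f_ k x| <= M) ->
    (forall x, f_ ^~ x @ \oo --> f x) -> trig_closure f.

Lemma trig_closure_bounded f : trig_closure f -> exists M, forall x, `|f x| <= M.
Proof.
elim=> [t c|a b {}f g _ [M fM] _ [N gN]|f_ {}f M _ _ fM f_f].
- by exists 1 => x; exact: cos_max.
- exists (`|a| * M + `|b| * N) => x.
  by rewrite (le_trans (ler_normD _ _))// !normrM lerD// ler_wpM2l.
- exists M => x; have /cvg_norm fx := f_f x.
  by apply: (cvgr_to_le fx); near=> k; exact: fM.
Unshelve. all: by end_near. Qed.

Lemma trig_closure_cst (c : R) : trig_closure (fun=> c).
Proof.
rewrite (_ : (fun=> c) = (fun x => c * cos (linear_form 0 x + 0) +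
                                   0 * cos (linear_form 0 x + 0))).
  by apply: trig_closure_lin; exact: trig_closure_cos.
apply/funext => x.
by rewrite /linear_form trmx0 mul0mx mxE addr0 cos0 mulr1 mul0r addr0.
Qed.

(** Nested induction on the two factors: generators multiply by the product-to-sum formula, and a
    limit in one factor remains a bounded limit because the other factor is bounded. *)
Lemma trig_closureM f g : trig_closure f -> trig_closure g ->
  trig_closure (fun x => f x * g x).
Proof.
move=> cf; elim: cf g => {f} [t c|a b f1 f2 _ h1 _ h2|f_ f M cf hf fM f_f] g cg.
- elim: cg => {g} [s e|a b g1 g2 _ h1 _ h2|g_ g M cg hg gM g_g].
  + rewrite (_ : (fun x => _) = (fun x => 2^-1 * cos (linear_form (t + s) x + (c + e)) +
                                 2^-1 * cos (linear_form (t - s) x + (c - e)))).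
      by apply: trig_closure_lin; exact: trig_closure_cos.
    apply/funext => x; rewrite !linear_formD linear_formN.
    set u := linear_form t x; set v := linear_form s x.
    have -> : u + v + (c + e) = (u + c) + (v + e) by ring.
    have -> : u - v + (c - e) = (u + c) - (v + e) by ring.
    by rewrite (cosD (u + c) (v + e)) (cosB (u + c) (v + e)); field.
  + rewrite (_ : (fun x => _) = (fun x => a * (cos (linear_form t x + c) * g1 x) +
                                 b * (cos (linear_form t x + c) * g2 x))).
      exact: trig_closure_lin.
    by apply/funext => x; ring.
  + apply: (trig_closure_lim (fun k x => cos (linear_form t x + c) * g_ k x) _ M) => //.
    * move=> k x; rewrite normrM (le_trans _ (gM k x))// ler_piMl//.
      exact: cos_max.
    * by move=> x; apply: cvgM => //; exact: cvg_cst.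
- rewrite (_ : (fun x => _) = (fun x => a * (f1 x * g x) + b * (f2 x * g x))).
    by apply: trig_closure_lin; [exact: h1|exact: h2].
  by apply/funext => x; ring.
- have [N gN] := trig_closure_bounded _ cg.
  apply: (trig_closure_lim (fun k x => f_ k x * g x) _ (M * N)) => //.
  + by move=> k; exact: hf.
  + by move=> k x; rewrite normrM ler_pM.
  + by move=> x; apply: cvgM => //; exact: cvg_cst.
Qed.

Lemma trig_closureD f g : trig_closure f -> trig_closure g ->
  trig_closure (fun x => f x + g x).
Proof.
move=> cf cg; rewrite (_ : (fun x => _) = (fun x => 1 * f x + 1 * g x)).
  exact: trig_closure_lin.
by apply/funext => x; rewrite !mul1r.
Qed.

Lemma trig_closureZ a f : trig_closure f -> trig_closure (fun x => a * f x).
Proof. by move=> cf; apply: trig_closureM => //; exact: trig_closure_cst. Qed.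

Lemma trig_closureN f : trig_closure f -> trig_closure (fun x => - f x).
Proof.
move=> /(trig_closureZ (-1)) cf.
by rewrite (_ : (fun x => _) = (fun x => -1 * f x))//; apply/funext => x; rewrite mulN1r.
Qed.

Lemma trig_closureB f g : trig_closure f -> trig_closure g ->
  trig_closure (fun x => f x - g x).
Proof. by move=> cf cg; apply: trig_closureD => //; exact: trig_closureN. Qed.

Lemma trig_closureX f k : trig_closure f -> trig_closure (fun x => f x ^+ k).
Proof.
move=> cf; elim: k => [|k cfk]; first exact: trig_closure_cst.
rewrite (_ : (fun x => _) = (fun x => f x * f x ^+ k)); first exact: trig_closureM.
by apply/funext => x; rewrite exprS.
Qed.

(** The partial sums of the exponential series are polynomials in [f], bounded by [expR M] when [f]
    is bounded by [M]. *)
Lemma trig_closure_expR f : trig_closure f -> trig_closure (fun x => expR (f x)).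
Proof.
move=> cf; have [M fM] := trig_closure_bounded _ cf.
apply: (trig_closure_lim (fun k x => series (exp_coeff (f x)) k) _ (expR M)).
- elim=> [|k ck].
    rewrite (_ : (fun x => _) = fun=> 0); first exact: trig_closure_cst.
    by apply/funext => x; rewrite /series/= big_geq.
  rewrite (_ : (fun x => _) =
     (fun x => series (exp_coeff (f x)) k + k`!%:R^-1 * f x ^+ k)).
    by apply: trig_closureD => //; apply: trig_closureZ; exact: trig_closureX.
  by apply/funext => x; rewrite seriesSr /exp_coeff/= mulrC.
- by move=> k x; exact: norm_series_exp_coeff_le.
- by move=> x; exact: is_cvg_series_exp_coeff.
Qed.

Lemma trig_closure_sin_approx m t c :
  trig_closure (fun x => sin_approx m (linear_form t x + c)).
Proof.
rewrite (_ : (fun x => _) = (fun x => m.+1%:R *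
   cos (linear_form (m.+1%:R^-1 *: t) x + (c / m.+1%:R - pi / 2)))).
  by apply: trig_closureZ; exact: trig_closure_cos.
apply/funext => x; rewrite /sin_approx addrA cosBpihalf; congr (_ * sin _).
by rewrite linear_formZ mulrDl (mulrC _^-1).
Qed.

(** Two successive limits: [m] to infinity at fixed [k] recovers the linear form from its sine
    approximation, then [k] to infinity yields the indicator. The unboundedness of the linear form
    does no harm, since [step_approx] stays in the unit interval. *)
Lemma trig_closure_gt0 t c :
  trig_closure (fun x => (0 < linear_form t x + c)%R%:R).
Proof.
apply: (trig_closure_lim (fun k x => step_approx k (linear_form t x + c)) _ 1).
- move=> k; apply: (trig_closure_lim
    (fun m x => step_approx k (sin_approx m (linear_form t x + c))) _ 1).
  + move=> m; apply: trig_closure_expR; apply: trig_closureN.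
    apply: trig_closure_expR; apply: trig_closureB.
      exact: trig_closure_cst.
    by apply: trig_closureZ; exact: trig_closure_sin_approx.
  + by move=> m x; exact: step_approx_norm_le1.
  + move=> x; rewrite /step_approx; apply: continuous_cvg; first exact: continuous_expR.
    apply: cvgN; apply: continuous_cvg; first exact: continuous_expR.
    apply: cvgB; first exact: cvg_cst.
    by apply: cvgM; [exact: cvg_cst|exact: cvg_sin_approx].
- by move=> k x; exact: step_approx_norm_le1.
- by move=> x; exact: cvg_step_approx.
Qed.

Lemma trig_closure_coord_ge i a : trig_closure (fun x => (a <= x i 0)%R%:R).
Proof.
rewrite (_ : (fun x => _) =
  (fun x => 1 - (0 < linear_form (- delta_mx i 0) x + a)%R%:R)).
  by apply: trig_closureB; [exact: trig_closure_cst|exact: trig_closure_gt0].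
apply/funext => x.
by rewrite linear_formN linear_form_delta (addrC _ a) subr_gt0 leNgt; case: ltP => _ /=; ring.
Qed.

Lemma trig_closure_coord_le i a : trig_closure (fun x => (x i 0 <= a)%R%:R).
Proof.
rewrite (_ : (fun x => _) =
  (fun x => 1 - (0 < linear_form (delta_mx i 0) x + - a)%R%:R)).
  by apply: trig_closureB; [exact: trig_closure_cst|exact: trig_closure_gt0].
apply/funext => x.
by rewrite linear_form_delta subr_gt0 leNgt; case: ltP => _ /=; ring.
Qed.

Lemma trig_closure_coord_itv i a b :
  trig_closure (fun x => (a <= x i 0 <= b)%R%:R).
Proof.
rewrite (_ : (fun x => _) = (fun x => (a <= x i 0)%R%:R * (x i 0 <= b)%R%:R)).
  by apply: trig_closureM; [exact: trig_closure_coord_ge|exact: trig_closure_coord_le].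
by apply/funext => x; case: (a <= _); rewrite ?mul1r ?mul0r.
Qed.

End trig_closure.

(** * Expectations and characteristic functions *)

Section expectation.
Context {R : realType} {dT : measure_display} {T : measurableType dT}.
Variable P : probability T R.
Implicit Types f g : T -> R.

Lemma bounded_integrable f M : measurable_fun setT f ->
  (forall w, `|f w| <= M) -> P.-integrable setT (EFin \o f).
Proof.
move=> mf fM; apply: measurable_bounded_integrable => //.
  by rewrite (le_lt_trans (probability_le1 P _)) ?ltry.
exists M; split; first exact: num_real.
by move=> x Mx w _; exact: le_trans (fM w) (ltW Mx).
Qed.

Lemma integrable_lin a b f g :
  P.-integrable setT (EFin \o f) -> P.-integrable setT (EFin \o g) ->
  P.-integrable setT (EFin \o (fun w => a * f w + b * g w)).
Proof.
move=> fi gi.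
rewrite (_ : _ \o _ = (fun w => a%:E * (EFin \o f) w) \+ (fun w => b%:E * (EFin \o g) w))%E.
  by apply: integrableD => //; exact: integrableZl.
by [].
Qed.

Lemma dominated_integrable_fun f g : measurable_fun setT f ->
  (forall w, `|f w| <= g w) -> P.-integrable setT (EFin \o g) ->
  P.-integrable setT (EFin \o f).
Proof.
move=> mf fg; apply: le_integrable => //; first exact/measurable_EFinP.
by move=> w _ /=; rewrite lee_fin (le_trans (fg w))// ler_norm.
Qed.

Lemma rexp_lin a b f g :
  P.-integrable setT (EFin \o f) -> P.-integrable setT (EFin \o g) ->
  rexp P (fun w => a * f w + b * g w) = a * rexp P f + b * rexp P g.
Proof.
move=> fi gi; rewrite /rexp -!/(Rintegral _ _ _).
rewrite RintegralD ?RintegralZl//.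
- by have := integrable_lin a 0 _ _ fi gi; under eq_fun do rewrite mul0r addr0.
- by have := integrable_lin 0 b _ _ fi gi; under eq_fun do rewrite mul0r add0r.
Qed.

Lemma rexp_cst c : rexp P (fun=> c) = c.
Proof.
rewrite /rexp -/(Rintegral _ _ _) Rintegral_cst//.
by have /= -> := probability_setT P; rewrite mulr1.
Qed.

Lemma rexp_le f g :
  P.-integrable setT (EFin \o f) -> P.-integrable setT (EFin \o g) ->
  (forall w, f w <= g w) -> rexp P f <= rexp P g.
Proof. by move=> fi gi fg; apply: le_Rintegral. Qed.

Lemma rexp_dominated_cvg (f_ : nat -> T -> R) f g :
  (forall k, measurable_fun setT (f_ k)) ->
  (forall w, f_ ^~ w @ \oo --> f w) ->
  P.-integrable setT (EFin \o g) -> (forall k w, `|f_ k w| <= g w) ->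
  (fun k => rexp P (f_ k)) @ \oo --> rexp P f.
Proof.
move=> mf_ f_f gi f_g.
have mf : measurable_fun setT f by apply: (measurable_fun_cvg mf_) => w _.
have fle w : `|f w| <= g w.
  by have /cvg_norm fx := f_f w; apply: (cvgr_to_le fx); near=> k; exact: f_g.
have mEf_ k : measurable_fun setT (EFin \o f_ k) by exact/measurable_EFinP.
have mEf : measurable_fun setT (EFin \o f) by exact/measurable_EFinP.
have Ef_f : {ae P, forall w, setT w -> (fun k => (EFin \o f_ k) w) @ \oo --> (EFin \o f) w}.
  by apply: aeW => w _; apply: cvg_EFin; [near=> k|exact: f_f].
have Ef_g : {ae P, forall w k, setT w -> (`|(EFin \o f_ k) w| <= (EFin \o g) w)%E}.
  by apply: aeW => w k _ /=; rewrite lee_fin.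
have [fi _ H] := dominated_convergence measurableT mEf_ mEf Ef_f gi Ef_g.
apply: fine_cvg; rewrite /rexp fineK//.
by apply: integrable_fin_num.
Unshelve. all: by end_near. Qed.

End expectation.

(** * Equality of characteristic functions, and what it transfers *)

Section characteristic_functions.
Context {R : realType} {dT : measure_display} {T : measurableType dT} {n : nat}.
Variable P : probability T R.
Implicit Types U W : T -> 'cV[R]_n.

Definition coord_measurable U := forall j, measurable_fun setT (fun w => U w j 0).

(** Real and imaginary parts are compared separately, which keeps all expectations real. *)
Definition eq_charfun U W := forall t : 'cV[R]_n,
  rexp P (fun w => cos (linear_form t (U w))) = rexp P (fun w => cos (linear_form t (W w))) /\
  rexp P (fun w => sin (linear_form t (U w))) = rexp P (fun w => sin (linear_form t (W w))).

Lemma measurable_linear_form U t : coord_measurable U ->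
  measurable_fun setT (fun w => linear_form t (U w)).
Proof.
move=> mU; rewrite /linear_form; under eq_fun do rewrite mxE.
by apply: measurable_sum => j; apply: measurable_funM.
Qed.

Lemma trig_closure_measurable U f : coord_measurable U -> trig_closure f ->
  measurable_fun setT (fun w => f (U w)).
Proof.
move=> mU; elim=> {f} [t c|a b f g _ mf _ mg|f_ f M _ mf_ _ f_f].
- apply: (@measurableT_comp _ _ _ _ _ _ (@cos R)).
    by apply: continuous_measurable_fun; exact: continuous_cos.
  by apply: measurable_funD => //; exact: measurable_linear_form.
- by apply: measurable_funD; exact: measurable_funM.
- by apply: (measurable_fun_cvg mf_) => w _; exact: f_f.
Qed.

Lemma trig_closure_integrable U f : coord_measurable U -> trig_closure f ->
  P.-integrable setT (EFin \o (fun w => f (U w))).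
Proof.
move=> mU cf; have [M fM] := trig_closure_bounded _ cf.
by apply: (@bounded_integrable _ _ _ _ _ M) => //; exact: trig_closure_measurable.
Qed.

(** Induction on the closure: generators are split by the addition formula into the cosine and sine
    expectations that agree by hypothesis, and limits are handled by dominated convergence and
    uniqueness of the limit. *)
Lemma eq_charfun_trig_closure U W f : coord_measurable U -> coord_measurable W ->
  eq_charfun U W -> trig_closure f ->
  rexp P (fun w => f (U w)) = rexp P (fun w => f (W w)).
Proof.
move=> mU mW UW; elim=> {f} [t c|a b f g cf IHf cg IHg|f_ f M cf_ IH f_M f_f].
- have cosE V : coord_measurable V -> rexp P (fun w => cos (linear_form t (V w) + c)) =
      cos c * rexp P (fun w => cos (linear_form t (V w))) +
      - sin c * rexp P (fun w => sin (linear_form t (V w))).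
    move=> mV; have mt := measurable_linear_form _ t mV.
    rewrite -rexp_lin.
    + by congr rexp; apply/funext => w; rewrite cosD; ring.
    + apply: (@bounded_integrable _ _ _ _ _ 1); last by move=> w; exact: cos_max.
      apply: (@measurableT_comp _ _ _ _ _ _ (@cos R)) => //.
      by apply: continuous_measurable_fun; exact: continuous_cos.
    + apply: (@bounded_integrable _ _ _ _ _ 1); last by move=> w; exact: sin_max.
      apply: (@measurableT_comp _ _ _ _ _ _ (@sin R)) => //.
      by apply: continuous_measurable_fun; exact: continuous_sin.
  by rewrite !cosE//; have [-> ->] := UW t.
- by rewrite !rexp_lin ?IHf ?IHg//; exact: trig_closure_integrable.
- have cvg V : coord_measurable V ->
      (fun k => rexp P (fun w => f_ k (V w))) @ \oo --> rexp P (fun w => f (V w)).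
    move=> mV; apply: (@rexp_dominated_cvg _ _ _ _ _ _ (fun=> M)) => //.
    + by move=> k; exact: trig_closure_measurable.
    + by apply: (@bounded_integrable _ _ _ _ _ `|M|).
  apply: (cvg_unique _ (cvg U mU)) => //.
  rewrite (_ : (fun k => _) = (fun k => rexp P (fun w => f_ k (W w)))); first exact: cvg.
  by apply/funext => k; exact: IH.
Qed.

Definition square_integrable U :=
  forall j, P.-integrable setT (fun w => ((U w j 0) ^+ 2)%:E).

(** Gives one integrable dominating function for the moments of orders 0, 1 and 2. *)
Lemma norm_exprn_le (x : R) k : (k <= 2)%N -> `|x| ^+ k <= 1 + x ^+ 2.
Proof.
rewrite -(real_normK (num_real x)); case: k => [|[|[|//]]] _.
- by rewrite expr0 lerDl sqr_ge0.
- by rewrite expr1; have := sqr_ge0 (`|x| - 1); have := normr_ge0 x; nra.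
- by rewrite lerDr.
Qed.

Lemma moment_dominator_integrable U M j : square_integrable U ->
  P.-integrable setT (EFin \o (fun w => M * (1 + U w j 0 ^+ 2))).
Proof.
move=> iU.
rewrite (_ : _ \o _ = EFin \o (fun w => M * cst 1 w + M * U w j 0 ^+ 2)).
  apply: integrable_lin; last exact: iU.
  by apply: (@bounded_integrable _ _ _ _ _ 1) => // w; rewrite normr1.
by apply/funext => w /=; rewrite mulrDr.
Qed.

Lemma moment_integrable U f j k : coord_measurable U -> square_integrable U ->
  trig_closure f -> (k <= 2)%N ->
  P.-integrable setT (EFin \o (fun w => f (U w) * U w j 0 ^+ k)).
Proof.
move=> mU iU cf k2; have [M fM] := trig_closure_bounded _ cf.
apply: dominated_integrable_fun (moment_dominator_integrable _ M j iU).
  apply: measurable_funM; first exact: trig_closure_measurable.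
  exact: measurable_funX.
by move=> w; rewrite normrM normrX ler_pM// norm_exprn_le.
Qed.

(** The monomial is unbounded, hence outside the closure. It is replaced by the power of its sine
    approximation, which lies in the closure, and the limit is taken under the dominator
    [M * (1 + x ^+ 2)]. *)
Lemma eq_charfun_moment U W f j k : coord_measurable U -> coord_measurable W ->
  square_integrable U -> square_integrable W ->
  eq_charfun U W -> trig_closure f -> (k <= 2)%N ->
  rexp P (fun w => f (U w) * U w j 0 ^+ k) = rexp P (fun w => f (W w) * W w j 0 ^+ k).
Proof.
move=> mU mW iU iW UW cf k2; have [M fM] := trig_closure_bounded _ cf.
pose f_ m (x : 'cV[R]_n) := f x * sin_approx m (linear_form (delta_mx j 0) x + 0) ^+ k.
have cf_ m : trig_closure (f_ m).
  by apply: trig_closureM => //; apply: trig_closureX; exact: trig_closure_sin_approx.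
have cvg V : coord_measurable V -> square_integrable V ->
    (fun m => rexp P (fun w => f_ m (V w))) @ \oo --> rexp P (fun w => f (V w) * V w j 0 ^+ k).
  move=> mV iV.
  apply: (@rexp_dominated_cvg _ _ _ _ _ _ (fun w => M * (1 + V w j 0 ^+ 2))) => //.
  + by move=> m; exact: trig_closure_measurable.
  + move=> w; rewrite /f_ linear_form_delta addr0.
    apply: cvgM; first exact: cvg_cst.
    apply: (@cvg_comp _ _ _ (sin_approx ^~ (V w j 0)) (fun y : R => y ^+ k)).
      exact: cvg_sin_approx.
    exact: exprn_continuous.
  + exact: moment_dominator_integrable.
  + move=> m w; rewrite /f_ linear_form_delta addr0 normrM normrX ler_pM//.
    by rewrite (le_trans _ (norm_exprn_le _ _ k2))// lerXn2r// norm_sin_approx_le.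
apply: (cvg_unique _ (cvg U mU iU)) => //.
rewrite (_ : (fun m => _) = (fun m => rexp P (fun w => f_ m (W w)))); first exact: cvg.
by apply/funext => m; exact: eq_charfun_trig_closure.
Qed.

End characteristic_functions.

(** * Spherical vectors *)

Section linear_images.
Context {R : realType} {dT : measure_display} {T : measurableType dT}.
Variable P : probability T R.

Lemma square_integrableD (f g : T -> R) :
  measurable_fun setT f -> measurable_fun setT g ->
  P.-integrable setT (EFin \o (fun w => f w ^+ 2)) ->
  P.-integrable setT (EFin \o (fun w => g w ^+ 2)) ->
  P.-integrable setT (EFin \o (fun w => (f w + g w) ^+ 2)).
Proof.
move=> mf mg fi gi.
apply: dominated_integrable_fun (integrable_lin _ 2 2 _ _ fi gi).
  by apply: measurable_funX; exact: measurable_funD.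
move=> w; rewrite ger0_norm ?sqr_ge0//.
by have := sqr_ge0 (f w - g w); nra.
Qed.

Lemma square_integrable_cst (c : R) :
  P.-integrable setT (EFin \o (fun _ : T => c ^+ 2)).
Proof. exact: (bounded_integrable _ _ `|c ^+ 2|). Qed.

Lemma square_integrableZ a (f : T -> R) :
  P.-integrable setT (EFin \o (fun w => f w ^+ 2)) ->
  P.-integrable setT (EFin \o (fun w => (a * f w) ^+ 2)).
Proof.
move=> fi; have := integrable_lin _ (a ^+ 2) 0 _ _ fi fi; congr (_.-integrable _ _).
by apply/funext => w /=; rewrite mul0r addr0 exprMn.
Qed.

Lemma coord_measurable_mulmx {n} (U : T -> 'cV[R]_n) (A : 'M[R]_n) :
  coord_measurable U -> coord_measurable (fun w => A *m U w).
Proof.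
move=> mU j; under eq_fun do rewrite mxE.
by apply: measurable_sum => k; apply: measurable_funM.
Qed.

Lemma square_integrable_mulmx {n} (U : T -> 'cV[R]_n) (A : 'M[R]_n) :
  coord_measurable U -> square_integrable P U ->
  square_integrable P (fun w => A *m U w).
Proof.
move=> mU iU j.
(* Measurability is carried through the induction because [square_integrableD] asks for it at each
   step. *)
have [] : measurable_fun setT (fun w => \sum_k A j k * U w k 0) /\
    P.-integrable setT (EFin \o (fun w => (\sum_k A j k * U w k 0) ^+ 2)).
  elim: (index_enum _) => [|k s [ms iS]].
    split; under eq_fun do rewrite big_nil; first exact: measurable_cst.
    exact: square_integrable_cst.
  have mk : measurable_fun setT (fun w => A j k * U w k 0) by exact: measurable_funM.
  split.
    by under eq_fun do rewrite big_cons; exact: measurable_funD.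
  rewrite (_ : _ \o _ =
      EFin \o (fun w => (A j k * U w k 0 + \sum_(l <- s) A j l * U w l 0) ^+ 2)).
    by apply: square_integrableD => //; apply: square_integrableZ; exact: iU.
  by apply/funext => w /=; rewrite big_cons.
by move=> _; congr (_.-integrable _ _); apply/funext => w /=; rewrite mxE.
Qed.

Lemma coord_measurableB {n} (U : T -> 'cV[R]_n) c :
  coord_measurable U -> coord_measurable (fun w => U w - c).
Proof.
move=> mU j; under eq_fun do rewrite !mxE.
exact: measurable_funB.
Qed.

Lemma square_integrableB {n} (U : T -> 'cV[R]_n) c :
  coord_measurable U -> square_integrable P U ->
  square_integrable P (fun w => U w - c).
Proof.
move=> mU iU j.
have := @square_integrableD _ (fun=> - c j 0) (mU j) (measurable_cst _) (iU j)
  (square_integrable_cst _).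
by congr (_.-integrable _ _); apply/funext => w /=; rewrite !mxE.
Qed.

End linear_images.

(** * Conditioning on an event given by a Boolean function *)

Section boolean_events.
Context {R : realType} {dT : measure_display} {T : measurableType dT}.
Variables (P : probability T R) (b : T -> bool).
Hypothesis mb : measurable_fun setT (fun w => (b w)%:R : R).

Lemma measurable_bool_event : measurable [set w | b w].
Proof.
have := mb measurableT _ (measurable_itv `[1, +oo[%R); rewrite setTI.
congr measurable; apply/seteqP; split => w /=; rewrite in_itv/= andbT.
  by case: (b w) => //; rewrite ler10.
by move=> ->.
Qed.

Lemma probability_bool_event : P [set w | b w] = (rexp P (fun w => (b w)%:R))%:E.
Proof.
have ib : P.-integrable setT (EFin \o (fun w => (b w)%:R : R)).
  by apply: (bounded_integrable _ _ 1) => // w; case: (b w); rewrite ?normr1 ?normr0.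
rewrite /rexp fineK; last by exact: integrable_fin_num.
rewrite -[in LHS](setIT [set w | b w]) -integral_indic//.
  by apply: eq_integral => w _; rewrite indicE mem_setE.
exact: measurable_bool_event.
Qed.

Lemma condE_bool_event f : condE P [set w | b w] f =
  rexp P (fun w => (b w)%:R * f w) / rexp P (fun w => (b w)%:R).
Proof.
rewrite /condE probability_bool_event/=; congr (_ / _).
rewrite integral_mkcond /rexp; congr fine; apply: eq_integral => w _.
by rewrite patchE mem_setE unfold_in; case: (b w); rewrite ?mul1r ?mul0r.
Qed.

End boolean_events.

(** * Quantiles under increasing affine maps *)

Section quantiles.
Context {R : realType} {dT : measure_display} {T : measurableType dT}.
Variable P : probability T R.

(** [has_inf S] excludes the default value of [inf], which an affine map would not respect. *)
Lemma inf_affine (S S' : set R) (m s : R) : 0 < s -> has_inf S ->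
  (forall x, S' (m + s * x) <-> S x) -> inf S' = m + s * inf S.
Proof.
move=> s0 [S0 Slb] SS'.
have sn0 : s != 0 by rewrite gt_eqF.
have xE x : x = m + s * ((x - m) / s) by field.
have S'0 : S' !=set0 by have [x Sx] := S0; exists (m + s * x); apply/SS'.
have S'lb : lbound S' (m + s * inf S).
  move=> x S'x; rewrite [X in _ <= X]xE lerD2l ler_wpM2l ?(ltW s0)//.
  by apply: (ge_inf Slb); apply/SS'; rewrite -xE.
apply/eqP; rewrite eq_le; apply/andP; split; last exact: lb_le_inf.
rewrite -lerBlDl -ler_pdivrMl//; apply: lb_le_inf => // x Sx.
rewrite ler_pdivrMl// lerBlDl.
by apply: ge_inf; [exists (m + s * inf S)|exact/SS'].
Qed.

Lemma quantile_affine (W : T -> R) (m s p : R) : 0 < s ->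
  has_inf [set x : R | (p%:E <= P [set w | (W w <= x)%R])%E] ->
  quantile P (fun w => m + s * W w) p = m + s * quantile P W p.
Proof.
move=> s0 hW; apply: inf_affine => // x /=.
rewrite (_ : [set w | m + s * W w <= m + s * x] = [set w | W w <= x])//.
by apply/seteqP; split => w /=; rewrite lerD2l ler_pM2l.
Qed.

End quantiles.

(** * Reduction of elliptical vectors to spherical ones *)

Section spherical.
Context {R : realType} {dT : measure_display} {T : measurableType dT} {n : nat}.
Variable P : probability T R.

Definition spherical (Z : T -> 'cV[R]_n) :=
  forall Q : 'M[R]_n, Q^T *m Q = 1%:M -> eq_charfun P (fun w => Q *m Z w) Z.

(** Whitening: the characteristic function of the transformed vector at [t] is [phi (t^T *m t)], and
    an orthogonal map preserves [t^T *m t]. *)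
Lemma elliptical_spherical (X : T -> 'cV[R]_n) mu Sigma phi (V : 'M[R]_n)
    (lam : 'I_n -> R) :
  coord_measurable X -> elliptical P X mu Sigma phi -> V^T *m V = 1%:M ->
  Sigma = V *m diag_mx (\row_j lam j) *m V^T -> (forall i, 0 < lam i) ->
  spherical (fun w => diag_mx (\row_j (Num.sqrt (lam j))^-1) *m V^T *m (X w - mu)).
Proof.
move=> mX ell VV SigmaE lam0.
set D := diag_mx _; set Z := fun w => _.
have ZE t w : linear_form t (Z w) =
    linear_form (V *m D *m t) (X w) + - linear_form (V *m D *m t) mu.
  rewrite /linear_form /Z !trmx_mul tr_diag_mx -/D !mulmxA mulmxBr !mxE.
  by [].
have quad t : (V *m D *m t)^T *m Sigma *m (V *m D *m t) = t^T *m t.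
  rewrite SigmaE !trmx_mul tr_diag_mx -/D !mulmxA.
  rewrite -(mulmxA _ V^T V) VV mulmx1 -(mulmxA _ V^T V) VV mulmx1.
  rewrite -(mulmxA t^T D) -(mulmxA t^T) -[X in _ = X *m _]mulmx1; congr (_ *m _ *m _).
  rewrite !mulmx_diag; apply/matrixP => i j; rewrite !mxE.
  case: eqP => [_|_]; rewrite ?mulr0n ?mulr1n//.
  have s0 : Num.sqrt (lam i) != 0 by rewrite gt_eqF// sqrtr_gt0.
  by rewrite -{2}(sqr_sqrtr (ltW (lam0 i))); field.
have char t :
    rexp P (fun w => cos (linear_form t (Z w))) = complex.Re (phi ((t^T *m t) 0 0)) /\
    rexp P (fun w => sin (linear_form t (Z w))) = complex.Im (phi ((t^T *m t) 0 0)).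
  set s := V *m D *m t.
  have [ic iS] : P.-integrable setT (EFin \o (fun w => cos (linear_form s (X w)))) /\
       P.-integrable setT (EFin \o (fun w => sin (linear_form s (X w)))).
    split.
    - have := @trig_closure_integrable _ _ _ _ P X _ mX (trig_closure_cos s 0).
      by congr (_.-integrable _ _); apply/funext => w /=; rewrite addr0.
    - have := @trig_closure_integrable _ _ _ _ P X _ mX (trig_closure_cos s (- (pi / 2))).
      by congr (_.-integrable _ _); apply/funext => w /=; rewrite cosBpihalf.
  under eq_fun do rewrite ZE.
  under [in X in _ /\ X]eq_fun do rewrite ZE.
  have := ell s; rewrite quad; case: (phi _) => a b /= [].
  rewrite -/(linear_form s mu); set c := linear_form s mu => Ec Es.
  (* Both parts are solved for by multiplying with the conjugate phase, using
     [cos c ^+ 2 + sin c ^+ 2 = 1]. *)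
  split.
  - rewrite (_ : (fun w => _) =
        (fun w => cos c * cos (linear_form s (X w)) + sin c * sin (linear_form s (X w)))).
      rewrite rexp_lin// Ec Es.
      by rewrite -[RHS]mulr1 -(cos2Dsin2 c); ring.
    by apply/funext => w; rewrite cosB; ring.
  - rewrite (_ : (fun w => _) =
        (fun w => - sin c * cos (linear_form s (X w)) + cos c * sin (linear_form s (X w)))).
      rewrite rexp_lin// Ec Es.
      by rewrite -[RHS]mulr1 -(cos2Dsin2 c); ring.
    by apply/funext => w; rewrite sinB; ring.
move=> Q QQ t.
have QE w : linear_form t (Q *m Z w) = linear_form (Q^T *m t) (Z w).
  by rewrite /linear_form trmx_mul trmxK mulmxA.
have /mulmx1C QQ' := QQ.
under eq_fun do rewrite QE; under [in X in _ /\ X]eq_fun do rewrite QE.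
have [-> ->] := char (Q^T *m t); have [-> ->] := char t.
by rewrite trmx_mul trmxK -mulmxA (mulmxA Q) QQ' mul1mx.
Qed.

Variable Z : T -> 'cV[R]_n.
Hypothesis mZ : coord_measurable Z.
Hypothesis iZ : square_integrable P Z.
Hypothesis sZ : spherical Z.

Lemma spherical_rexp Q f : Q^T *m Q = 1%:M -> trig_closure f ->
  rexp P (fun w => f (Q *m Z w)) = rexp P (fun w => f (Z w)).
Proof.
move=> QQ cf; apply: eq_charfun_trig_closure => //; last exact: sZ.
exact: coord_measurable_mulmx.
Qed.

Lemma spherical_moment Q f j k : Q^T *m Q = 1%:M -> trig_closure f -> (k <= 2)%N ->
  rexp P (fun w => f (Q *m Z w) * (Q *m Z w) j 0 ^+ k) =
  rexp P (fun w => f (Z w) * Z w j 0 ^+ k).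
Proof.
move=> QQ cf k2; apply: eq_charfun_moment => //; last exact: sZ.
- exact: coord_measurable_mulmx.
- exact: square_integrable_mulmx.
Qed.

(** * Moments and variances truncated to a slab in one coordinate *)

Definition itv_moment a b i j k : R :=
  rexp P (fun w => (a <= Z w i 0 <= b)%R%:R * Z w j 0 ^+ k).

Lemma itv_moment_perm (s : {perm 'I_n}) a b i j k : (k <= 2)%N ->
  itv_moment a b (s i) (s j) k = itv_moment a b i j k.
Proof.
move=> k2; have QQ : (perm_mx s)^T *m perm_mx s = 1%:M :> 'M[R]_n.
  by rewrite tr_perm_mx -perm_mxM mulVg perm_mx1.
rewrite /itv_moment -(spherical_moment _ _ j k QQ (trig_closure_coord_itv i a b) k2).
by congr rexp; apply/funext => w; rewrite -row_permE !mxE.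
Qed.

Lemma itv_moment_opp a b i j k : (k <= 2)%N ->
  itv_moment a b i j k = (-1) ^+ k * itv_moment (- b) (- a) i j k.
Proof.
move=> k2; have QQ : (-1)%:M^T *m (-1)%:M = 1%:M :> 'M[R]_n.
  by rewrite tr_scalar_mx -scalar_mxM mulrNN mulr1.
rewrite /itv_moment -(spherical_moment _ _ j k QQ (trig_closure_coord_itv i a b) k2).
(* Linearity with second coefficient 0 serves as homogeneity. *)
have := rexp_lin P ((-1) ^+ k) 0 _ _
  (moment_integrable P _ _ j k mZ iZ (trig_closure_coord_itv i (- b) (- a)) k2)
  (moment_integrable P _ _ j k mZ iZ (trig_closure_coord_itv i (- b) (- a)) k2).
rewrite mul0r addr0 => <-; congr rexp; apply/funext => w.
rewrite mul_scalar_mx !mxE exprMn !mulN1r lerNr lerNl andbC.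
by rewrite mul0r addr0 mulrCA.
Qed.

(** Flipping the sign of coordinate [j] alone is orthogonal and fixes the slab in coordinate [i], so
    the moment equals its opposite. *)
Lemma itv_moment1_eq0 a b i j : i != j -> itv_moment a b i j 1 = 0.
Proof.
move=> ij; pose Q : 'M[R]_n := diag_mx (\row_l (-1) ^+ (l == j)).
have QQ : Q^T *m Q = 1%:M.
  rewrite /Q tr_diag_mx mulmx_diag; apply/matrixP => l m; rewrite !mxE.
  by rewrite -expr2 sqrr_sign.
suff : itv_moment a b i j 1 = - itv_moment a b i j 1 by lra.
rewrite {1}/itv_moment -(spherical_moment _ _ j 1 QQ (trig_closure_coord_itv i a b))//.
have := rexp_lin P (-1) 0 _ _
  (moment_integrable P _ _ j 1 mZ iZ (trig_closure_coord_itv i a b) isT)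
  (moment_integrable P _ _ j 1 mZ iZ (trig_closure_coord_itv i a b) isT).
rewrite mul0r addr0 mulN1r => <-; congr rexp; apply/funext => w.
rewrite /Q mul_diag_mx !mxE eqxx (negbTE ij) expr0 mul1r !expr1; ring.
Qed.

(** The interval contains 0 but may be asymmetric: the two trimming quantiles need not be opposite
    when the distribution function is flat at their levels. Adding the reflected interval leaves a
    nonincreasing function of [|x|]. *)
Lemma symmetrized_itvE (a b x : R) : a <= 0 -> 0 <= b ->
  (a <= x <= b)%R%:R + (- b <= x <= - a)%R%:R =
  (`|x| <= b)%R%:R + (`|x| <= - a)%R%:R :> R.
Proof.
move=> a0 b0; have [x0|x0] := leP 0 x.
- by rewrite (le_trans a0 x0) (le_trans _ x0) ?oppr_le0// ger0_norm.
- rewrite (ltr0_norm x0) (ltW (lt_le_trans x0 b0)) (ltW (lt_le_trans x0 _)) ?oppr_ge0//.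
  by rewrite !andbT addrC lerNl lerN2.
Qed.

Lemma symmetrized_itv_antitone (a b x y : R) : a <= 0 -> 0 <= b ->
  ((a <= x <= b)%R%:R + (- b <= x <= - a)%R%:R -
   ((a <= y <= b)%R%:R + (- b <= y <= - a)%R%:R)) * (x ^+ 2 - y ^+ 2) <= 0.
Proof.
move=> a0 b0; rewrite !symmetrized_itvE//.
have le_ind c (u v : R) : u <= v -> (v <= c)%R%:R <= (u <= c)%R%:R :> R.
  by move=> uv; case: (leP v c) => // vc; rewrite (le_trans uv vc).
rewrite -(real_normK (num_real x)) -(real_normK (num_real y)).
have [xy|/ltW xy] := leP `|x| `|y|.
- apply: mulr_ge0_le0; first by rewrite subr_ge0 lerD// le_ind.
  by rewrite subr_le0 lerXn2r.
- apply: mulr_le0_ge0; first by rewrite subr_le0 lerD// le_ind.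
  by rewrite subr_ge0 lerXn2r.
Qed.

(* Averaging over the swap of the two coordinates and over the point
   reflection turns the difference of the two moments into the expectation of
   [(F x - F y) * (x ^+ 2 - y ^+ 2)], where [F] decreases with [`|x|]. *)
Lemma itv_moment2_le a b i j : a <= 0 -> 0 <= b ->
  itv_moment a b i i 2 <= itv_moment a b i j 2.
Proof.
move=> a0 b0.
pose F (l : 'I_n) (x : 'cV[R]_n) : R :=
  1 * (a <= x l 0 <= b)%R%:R + 1 * (- b <= x l 0 <= - a)%R%:R.
pose G (x : 'cV[R]_n) : R := 1 * F i x + -1 * F j x.
have cF l : trig_closure (F l).
  by apply: trig_closure_lin; exact: trig_closure_coord_itv.
have cG : trig_closure G by exact: trig_closure_lin.
pose M f l := rexp P (fun w => f (Z w) * Z w l 0 ^+ 2).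
have iM f l : trig_closure f ->
    P.-integrable setT (EFin \o (fun w => f (Z w) * Z w l 0 ^+ 2)).
  by move=> cf; exact: moment_integrable.
have Mlin c d f g l : trig_closure f -> trig_closure g ->
    M (fun x => c * f x + d * g x) l = c * M f l + d * M g l.
  move=> cf cg; rewrite /M -rexp_lin; [|exact: iM|exact: iM].
  by congr rexp; apply/funext => w; ring.
(* The reflected interval contributes the same amount, since the second moment is even. *)
have FE l m : M (F l) m = 2 * itv_moment a b l m 2.
  rewrite Mlin; [|exact: trig_closure_coord_itv|exact: trig_closure_coord_itv].
  change (1 * itv_moment a b l m 2 + 1 * itv_moment (- b) (- a) l m 2 =
    2 * itv_moment a b l m 2).
  by rewrite (itv_moment_opp a b)// sqrrN expr1n; ring.
have jj : itv_moment a b j j 2 = itv_moment a b i i 2.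
  by rewrite -(itv_moment_perm (tperm i j) a b i i)// tpermL.
have ji : itv_moment a b j i 2 = itv_moment a b i j 2.
  by rewrite -(itv_moment_perm (tperm i j) a b i j)// tpermL tpermR.
(* By [FE], [jj] and [ji] the left side is four times [itv_moment a b i i 2 - itv_moment a b i j
   2]. *)
have : M G i - M G j <= 0.
  have -> : M G i - M G j =
      rexp P (fun w => 1 * (G (Z w) * Z w i 0 ^+ 2) + -1 * (G (Z w) * Z w j 0 ^+ 2)).
    by rewrite rexp_lin ?mul1r ?mulN1r//; exact: iM.
  rewrite -(rexp_cst P 0); apply: rexp_le.
  - by apply: integrable_lin; exact: iM.
  - by apply: (bounded_integrable _ _ 0) => // w; rewrite normr0.
  - move=> w; rewrite mul1r mulN1r -mulrBr /G /F !mul1r mulN1r.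
    exact: symmetrized_itv_antitone.
have GE l : M G l = 1 * M (F i) l + -1 * M (F j) l by exact: Mlin.
by rewrite !GE !FE jj ji; lra.
Qed.

(** Second moment minus squared mean under conditioning; division by zero makes it 0 on a null
    slab. *)
Definition itv_var a b i j : R :=
  itv_moment a b i j 2 / itv_moment a b i j 0 -
  (itv_moment a b i j 1 / itv_moment a b i j 0) ^+ 2.

Lemma itv_moment0E a b i j :
  itv_moment a b i j 0 = rexp P (fun w => (a <= Z w i 0 <= b)%R%:R).
Proof. by congr rexp; apply/funext => w; rewrite expr0 mulr1. Qed.

(** The conditional mean of coordinate [j] vanishes, while that of coordinate [i] can only lower the
    left side, so comparing second moments suffices. *)
Lemma itv_var_le a b i j : a <= 0 -> 0 <= b -> i != j ->
  itv_var a b i i <= itv_var a b i j.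
Proof.
move=> a0 b0 ij.
rewrite /itv_var (itv_moment1_eq0 a b i j ij) mul0r expr0n subr0 !itv_moment0E.
set p := rexp P _.
have p0 : 0 <= p.
  rewrite -(rexp_cst P 0); apply: rexp_le => //.
  - by apply: (bounded_integrable _ _ 0) => // w; rewrite normr0.
  - exact: (@trig_closure_integrable _ _ _ _ P Z _ mZ (trig_closure_coord_itv i a b)).
apply: (@le_trans _ _ (itv_moment a b i i 2 / p)).
  by rewrite lerBlDr lerDl sqr_ge0.
by rewrite ler_wpM2r ?itv_moment2_le// invr_ge0.
Qed.

Lemma itv_var_perm (s : {perm 'I_n}) a b i j :
  itv_var a b (s i) (s j) = itv_var a b i j.
Proof. by rewrite /itv_var !itv_moment_perm. Qed.

Lemma spherical_measurable_itv a b i :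
  measurable_fun setT (fun w => (a <= Z w i 0 <= b)%R%:R : R).
Proof.
exact: (@trig_closure_measurable _ _ _ _ Z _ mZ (trig_closure_coord_itv i a b)).
Qed.

Lemma condE_itv_var a b i j (c s : R) :
  let A := [set w | a <= Z w i 0 <= b] in
  let e := condE P A (fun w => c + s * Z w j 0) in
  condE P A (fun w => (c + s * Z w j 0 - e) * (c + s * Z w j 0 - e)) =
  s ^+ 2 * itv_var a b i j.
Proof.
move=> A e; have mA := spherical_measurable_itv a b i.
have condEE f : condE P A f =
    rexp P (fun w => (a <= Z w i 0 <= b)%R%:R * f w) / itv_moment a b i j 0.
  by rewrite itv_moment0E; exact: condE_bool_event.
have im k : (k <= 2)%N ->
    P.-integrable setT (EFin \o (fun w => (a <= Z w i 0 <= b)%R%:R * Z w j 0 ^+ k)).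
  by move=> k2; exact: (moment_integrable P _ _ j k mZ iZ (trig_closure_coord_itv i a b) k2).
rewrite condEE /itv_var.
(* On a null event both sides are 0, as the inverse of 0 is 0. *)
have [p0|p0] := eqVneq (itv_moment a b i j 0) 0.
  by rewrite p0 invr0 !mulr0 expr0n subr0 mulr0.
have eE : e = c + s * (itv_moment a b i j 1 / itv_moment a b i j 0).
  rewrite /e condEE (_ : rexp _ _ = c * itv_moment a b i j 0 + s * itv_moment a b i j 1).
    by field.
  rewrite /itv_moment -rexp_lin; [|exact: im|exact: im].
  by congr rexp; apply/funext => w; rewrite expr0 expr1; ring.
set d := itv_moment a b i j 1 / itv_moment a b i j 0 in eE *.
(* Expansion of [s ^+ 2 * (Z - d) ^+ 2], nested in pairs to match [rexp_lin]. *)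
rewrite (_ : rexp _ _ = 1 * (s ^+ 2 * itv_moment a b i j 2 +
    (- (2 * s ^+ 2 * d)) * itv_moment a b i j 1) + s ^+ 2 * d ^+ 2 * itv_moment a b i j 0).
  by rewrite /d; field.
rewrite /itv_moment -rexp_lin; [|exact: im|exact: im].
rewrite -rexp_lin; [|by apply: integrable_lin; exact: im|exact: im].
by congr rexp; apply/funext => w; rewrite eE expr0 expr1; ring.
Qed.

(** * Marginal distribution functions and the signs of their quantiles *)

Definition marginal_cdf i (x : R) : R := rexp P (fun w => (Z w i 0 <= x)%R%:R).

Lemma marginal_cdfE i x :
  P [set w | (Z w i 0 <= x)%R] = (marginal_cdf i x)%:E.
Proof.
apply: probability_bool_event.
exact: (@trig_closure_measurable _ _ _ _ Z _ mZ (trig_closure_coord_le i x)).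
Qed.

Lemma marginal_cdf_perm i j x : marginal_cdf i x = marginal_cdf j x.
Proof.
have QQ : (tperm_mx i j)^T *m tperm_mx i j = 1%:M :> 'M[R]_n.
  by rewrite tr_perm_mx -perm_mxM mulVg perm_mx1.
rewrite /marginal_cdf -(spherical_rexp _ _ QQ (trig_closure_coord_le i x)).
by congr rexp; apply/funext => w; rewrite -row_permE !mxE tpermL.
Qed.

Lemma marginal_cdf_opp i x :
  marginal_cdf i x = rexp P (fun w => (- x <= Z w i 0)%R%:R).
Proof.
have QQ : (-1)%:M^T *m (-1)%:M = 1%:M :> 'M[R]_n.
  by rewrite tr_scalar_mx -scalar_mxM mulrNN mulr1.
rewrite /marginal_cdf -(spherical_rexp _ _ QQ (trig_closure_coord_le i x)).
by congr rexp; apply/funext => w; rewrite mul_scalar_mx !mxE mulN1r lerNl.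
Qed.

(** Compares the distribution function with 1/2 pointwise: the two half-lines cover the line when
    [x = 0] and are disjoint when [x < 0]. *)
Lemma marginal_cdf_double i x : 2 * marginal_cdf i x =
  rexp P (fun w => 1 * (Z w i 0 <= x)%R%:R + 1 * (- x <= Z w i 0)%R%:R).
Proof.
rewrite rexp_lin; first by rewrite -marginal_cdf_opp -/(marginal_cdf i x); ring.
- exact: (@trig_closure_integrable _ _ _ _ P Z _ mZ (trig_closure_coord_le i x)).
- exact: (@trig_closure_integrable _ _ _ _ P Z _ mZ (trig_closure_coord_ge i (- x))).
Qed.

Let integrable_two_tails i x : P.-integrable setT
  (EFin \o (fun w => 1 * (Z w i 0 <= x)%R%:R + 1 * (- x <= Z w i 0)%R%:R)).
Proof.
apply: integrable_lin.
- exact: (@trig_closure_integrable _ _ _ _ P Z _ mZ (trig_closure_coord_le i x)).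
- exact: (@trig_closure_integrable _ _ _ _ P Z _ mZ (trig_closure_coord_ge i (- x))).
Qed.

Let integrable_one : P.-integrable setT (EFin \o (fun _ : T => 1 : R)).
Proof. by apply: (bounded_integrable _ _ 1) => // w; rewrite normr1. Qed.

Lemma marginal_cdf0_ge i : 2^-1 <= marginal_cdf i 0.
Proof.
suff : 1 <= 2 * marginal_cdf i 0 by lra.
rewrite marginal_cdf_double -[X in X <= _](rexp_cst P); apply: rexp_le => // w.
by rewrite oppr0 !mul1r; case: (leP (Z w i 0) 0) => [_|/ltW ->]; rewrite ?add0r// lerDl ler0n.
Qed.

Lemma marginal_cdf_lt0_le i x : x < 0 -> marginal_cdf i x <= 2^-1.
Proof.
move=> x0; suff : 2 * marginal_cdf i x <= 1 by lra.
rewrite marginal_cdf_double -[X in _ <= X](rexp_cst P); apply: rexp_le => // w.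
rewrite !mul1r; case: (leP (Z w i 0) x) => [Zx|_]; last by rewrite add0r lern1 leq_b1.
suff /lt_geF -> : Z w i 0 < - x by rewrite addr0.
by rewrite (le_lt_trans Zx)// (lt_trans x0)// oppr_gt0.
Qed.

Lemma marginal_cdf_cvg1 i : (fun k : nat => marginal_cdf i k%:R) @ \oo --> (1 : R).
Proof.
rewrite -[X in _ --> X](rexp_cst P).
apply: (rexp_dominated_cvg _ _ _ (fun=> 1)) => //.
- by move=> k; exact: (@trig_closure_measurable _ _ _ _ Z _ mZ (trig_closure_coord_le i k%:R)).
- move=> w; apply: cvg_near_cst; near=> k.
  suff -> : Z w i 0 <= k%:R by [].
  by near: k; exact: nbhs_infty_ger.
- by move=> k w; case: (Z w i 0 <= _); rewrite ?normr1 ?normr0.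
Unshelve. all: by end_near. Qed.

Lemma marginal_cdf_cvg0 i : (fun k : nat => marginal_cdf i (- k%:R)) @ \oo --> (0 : R).
Proof.
rewrite -[X in _ --> X](rexp_cst P).
apply: (rexp_dominated_cvg _ _ _ (fun=> 1)) => //.
- move=> k.
  exact: (@trig_closure_measurable _ _ _ _ Z _ mZ (trig_closure_coord_le i (- k%:R))).
- move=> w; apply: cvg_near_cst; near=> k.
  rewrite leNgt; suff -> : - k%:R < Z w i 0 by [].
  by rewrite ltrNl; near: k; exact: nbhs_infty_gtr.
- by move=> k w; case: (Z w i 0 <= _); rewrite ?normr1 ?normr0.
Unshelve. all: by end_near. Qed.

Lemma marginal_cdf_nondecreasing i x y : x <= y -> marginal_cdf i x <= marginal_cdf i y.
Proof.
move=> xy; apply: rexp_le.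
- exact: (@trig_closure_integrable _ _ _ _ P Z _ mZ (trig_closure_coord_le i x)).
- exact: (@trig_closure_integrable _ _ _ _ P Z _ mZ (trig_closure_coord_le i y)).
- by move=> w; case: (leP _ x) => // Zx; rewrite (le_trans Zx xy).
Qed.

(** The limit 1 at plus infinity gives a point of the set, the limit 0 at minus infinity a lower
    bound. *)
Lemma has_inf_quantile i p : 0 < p < 1 ->
  has_inf [set x : R | (p%:E <= P [set w | (Z w i 0 <= x)%R])%E].
Proof.
move=> /andP[p0 p1]; split.
- have /cvgr_ge/(_ _ p1)[k _ kp] := marginal_cdf_cvg1 i.
  by exists k%:R; rewrite /= marginal_cdfE lee_fin; exact: (kp k (leqnn k)).
- have /cvgr_lt/(_ _ p0)[k _ kp] := marginal_cdf_cvg0 i.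
  exists (- k%:R) => x /=; rewrite marginal_cdfE lee_fin => px.
  rewrite leNgt; apply/negP => /ltW/(marginal_cdf_nondecreasing i) xk.
  by have := le_lt_trans (le_trans px xk) (kp k (leqnn k)); rewrite ltxx.
Qed.

Lemma marginal_quantile_perm i j p :
  quantile P (fun w => Z w i 0) p = quantile P (fun w => Z w j 0) p.
Proof.
congr inf; apply/funext => x /=.
by rewrite !marginal_cdfE (marginal_cdf_perm i j).
Qed.

Lemma marginal_quantile_le0 i p : 0 < p -> p <= 2^-1 ->
  quantile P (fun w => Z w i 0) p <= 0.
Proof.
move=> p0 p12; apply: ge_inf.
  by have [] := has_inf_quantile i p; first by rewrite p0 (le_lt_trans p12)//; lra.
by rewrite /= marginal_cdfE lee_fin (le_trans p12)// marginal_cdf0_ge.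
Qed.

(** The inequality [2^-1 < p] is strict because the quantile, being an infimum, can be negative at
    level 1/2. *)
Lemma marginal_quantile_ge0 i p : 2^-1 < p -> p < 1 ->
  0 <= quantile P (fun w => Z w i 0) p.
Proof.
move=> p12 p1; apply: lb_le_inf.
  by have [] := has_inf_quantile i p; first by rewrite p1 andbT; lra.
move=> x; rewrite /= marginal_cdfE lee_fin => px.
rewrite leNgt; apply/negP => /(marginal_cdf_lt0_le i) x0.
by have := lt_le_trans p12 (le_trans px x0); rewrite ltxx.
Qed.

Lemma trim_event_affine i (c s alpha : R) : 0 < s -> 0 < alpha < 1 ->
  trim_event P (fun w => c + s * Z w i 0) alpha =
  trim_event P (fun w => Z w i 0) alpha.
Proof.
move=> s0 /andP[a0 a1].
rewrite /trim_event !quantile_affine//; [|apply: has_inf_quantile; lra..].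
by apply/seteqP; split => w /=; rewrite !lerD2l !ler_pM2l.
Qed.

End spherical.

(** * Exchange argument and conclusion *)

Lemma sum_swap_le {R : realDomainType} {n : nat} (lam : 'I_n -> R)
    (v : 'I_n -> 'I_n -> R) i j : i != j ->
  (forall k, v i k = v j (tperm i j k)) -> v i i <= v i j -> lam j <= lam i ->
  \sum_k lam k * v i k <= \sum_k lam k * v j k.
Proof.
move=> ij vE vij lamij.
rewrite (bigD1 i)//= (bigD1 j)/=; last by rewrite eq_sym.
rewrite [X in _ <= X](bigD1 i)//= [X in _ <= _ + X](bigD1 j)/=; last by rewrite eq_sym.
(* The transposition fixes every index other than [i] and [j], so those terms agree and cancel. *)
rewrite [X in _ + (_ + X) <= _](eq_bigr (fun k => lam k * v j k)); last first.
  by move=> k /andP[ki kj]; rewrite vE tpermD// eq_sym.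
have <- : v i j = v j i by rewrite vE tpermR.
have <- : v i i = v j j by rewrite vE tpermL.
rewrite !addrA lerD2r; nra.
Qed.

(* dimension d = n.+1 >= 1; index 1 is ord0, index d is ord_max *)
Theorem theorem6 (R : realType) (dT : measure_display) (T : measurableType dT)
  (P : probability T R) (n : nat) (X : T -> 'cV[R]_n.+1)
  (mu : 'cV[R]_n.+1) (Sigma : 'M[R]_n.+1) (phi : R -> R[i])
  (V : 'M[R]_n.+1) (lam : 'I_n.+1 -> R) (alpha : R) :
  (forall j, measurable_fun setT (fun w => X w j 0)) ->
  (forall j, P.-integrable setT (fun w => ((X w j 0) ^+ 2)%:E)) ->
  (forall j k, Sigma j k = rcov P (fun w => X w j 0) (fun w => X w k 0)) ->
  elliptical P X mu Sigma phi ->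
  V^T *m V = 1%:M ->
  Sigma = V *m diag_mx (\row_j lam j) *m V^T ->
  (forall i j : 'I_n.+1, (i <= j)%N -> lam j <= lam i) ->
  (forall i, 0 < lam i) ->
  0 < alpha < 1 ->
  let Y := fun w => V^T *m X w in
  forall i : 'I_n.+1,
    \tr (condCov P (trim_event P (fun w => Y w ord0 0) alpha) Y)
      <= \tr (condCov P (trim_event P (fun w => Y w i 0) alpha) Y)
    /\ \tr (condCov P (trim_event P (fun w => Y w i 0) alpha) Y)
      <= \tr (condCov P (trim_event P (fun w => Y w ord_max 0) alpha) Y).
Proof.
move=> mX iX _ ell VV SigmaE lam_le lam0 a01 Y i.
pose Z w := diag_mx (\row_j (Num.sqrt (lam j))^-1) *m V^T *m (X w - mu).
have mX' : coord_measurable (fun w => X w - mu) by exact: coord_measurableB.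
have mZ : coord_measurable Z by exact: coord_measurable_mulmx.
have iZ : square_integrable P Z.
  by apply: square_integrable_mulmx => //; exact: square_integrableB.
have sZ : spherical P Z by exact: elliptical_spherical ell VV SigmaE lam0.
(* Each principal component is an increasing affine function of the matching coordinate of [Z]. *)
have YE j : (fun w => Y w j 0) =
    (fun w => (V^T *m mu) j 0 + Num.sqrt (lam j) * Z w j 0).
  apply/funext => w; rewrite /Z -mulmxA mul_diag_mx mulmxBr [in RHS]mxE.
  rewrite [in X in _ + _ * (X * _)]mxE [in X in _ + _ * (_ * X)]mxE.
  rewrite [in X in _ + _ * (_ * (_ + X))]mxE mulrA divff ?mul1r.
    by rewrite addrC subrK.
  by rewrite gt_eqF// sqrtr_gt0.
have [alpha0 alpha1] := andP a01.
(* All coordinates of [Z] share the same quantiles, so index [ord0] stands for any of them. *)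
pose q := quantile P (fun w => Z w ord0 0).
(* Trimming [Y] at [j] is thus a slab in [Z] with endpoints common to all [j]; the weight [lam k] is
   the square of the scale of coordinate [k]. *)
have trE j : \tr (condCov P (trim_event P (fun w => Y w j 0) alpha) Y) =
    \sum_k lam k * itv_var P Z (q (alpha / 2)) (q (1 - alpha / 2)) j k.
  rewrite YE (trim_event_affine P Z) ?sqrtr_gt0// /trim_event.
  rewrite !(marginal_quantile_perm P Z mZ sZ j ord0) -/q.
  apply: eq_bigr => k _; rewrite mxE -[in RHS](sqr_sqrtr (ltW (lam0 k))).
  rewrite -(condE_itv_var P Z mZ iZ _ _ _ _ ((V^T *m mu) k 0)) -YE.
  by congr condE; apply/funext => w; rewrite (congr1 (@^~ w) (YE k)).
have ql0 : q (alpha / 2) <= 0 by apply: marginal_quantile_le0 => //; lra.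
have qu0 : 0 <= q (1 - alpha / 2) by apply: marginal_quantile_ge0 => //; lra.
have tr_le j k : lam k <= lam j ->
    \tr (condCov P (trim_event P (fun w => Y w j 0) alpha) Y) <=
    \tr (condCov P (trim_event P (fun w => Y w k 0) alpha) Y).
  have [->//|jk lamkj] := eqVneq j k; rewrite !trE; apply: sum_swap_le => //.
    by move=> l; rewrite -(itv_var_perm P Z mZ iZ sZ (tperm j k)) tpermL.
  exact: itv_var_le.
by split; apply: tr_le; apply: lam_le; rewrite ?leq0n ?leq_ord.
Qed.
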